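(* Let $n>2$ be a natural number and let $\digamma_n\subset\mathbb{C}^n$ be the set of all vectors of the form $$w=\left[\sum_{k=0}^{n-1}\lambda^{k},\ \sum_{k=0}^{n-1}\lambda^{k}e^{-\frac{2\pi k i}{n}},\ \ldots,\ \sum_{k=0}^{n-1}\lambda^{k}e^{-\frac{2\pi k(n-1)i}{n}}\right]^{T},$$ (that is, the coordinate of $w$ with index $j\in\{0,\dots,n-1\}$ is $\sum_{k=0}^{n-1}\lambda^k e^{-2\pi i kj/n}$), where $\lambda\in\mathbb{C}$ is either transcendental, or algebraic over $\mathbb{Q}\left(e^{2\pi i/n}\right)$ of degree at least $n^2-n+1$ over $\mathbb{Q}\left(e^{2\pi i/n}\right)$. If $n$ is odd and $w\in\digamma_n$, then $D_{2n}w$ is a full spark frame.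
   Context: Coordinates of vectors in $\mathbb{C}^n$ are indexed by $\mathbb{Z}_n=\{0,1,\dots,n-1\}$. Let $T,D\in GL(n,\mathbb{C})$ be the permutation matrices acting by $(Tv)(j)=v((j-1)\bmod n)$ and $(Dv)(j)=v((n-j)\bmod n)$ for $v\in\mathbb{C}^n$, $j\in\mathbb{Z}_n$. $D_{2n}$ is the (dihedral) subgroup of $GL(n,\mathbb{C})$ generated by $T$ and $D$; it has order $2n$ for $n>2$. For $w\in\mathbb{C}^n$, $D_{2n}w=\{gw: g\in D_{2n}\}$ is the orbit of $w$. A set $\mathfrak{F}$ of $m\ge n$ vectors in $\mathbb{C}^n$ is called a full spark frame (or is said to have the Haar property) if every subset of $\mathfrak{F}$ of cardinality $n$ is a basis of $\mathbb{C}^n$. *)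

(* Defs.v *)
(* The complex numbers are R[i] for R : realType; expi t = e^{it}. *)
From mathcomp Require Import all_boot all_order all_algebra finmap.
From mathcomp Require Import all_classical all_reals.
From mathcomp Require Import trigo.
From mathcomp.real_closed Require Export complex.

Set Implicit Arguments.
Unset Strict Implicit.
Unset Printing Implicit Defensive.

Import Order.TTheory GRing.Theory Num.Theory.

Local Open Scope classical_set_scope.
Local Open Scope ring_scope.
Local Open Scope complex_scope.

Section GeneratedField.
Variable L : fieldType.

(* The subfield of L generated by x: the intersection of all subfields
   containing x.  The prime field is contained in every subfield, so for
   L of characteristic 0 this is Q(x). *)
Definition gen_subfield (x : L) : {pred L} :=
  fun y => `[< forall S : {pred L}, divring_closed S -> x \in S -> y \in S >].

Definition is_min_poly (K : {pred L}) (x : L) (p : {poly L}) : Prop :=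
  [/\ p \is monic, p \is a polyOver K, root p x &
      forall q : {poly L},
        q \is a polyOver K -> q != 0 -> root q x -> (size p <= size q)%N].

(* size p = degree of p + 1.  In particular x is algebraic over K. *)
Definition algebraic_of_degree (K : {pred L}) (x : L) (d : nat) : Prop :=
  exists2 p : {poly L}, is_min_poly K x p & size p = d.+1.

End GeneratedField.

Section Dihedral.
Variables (F : fieldType) (n : nat).

(* (T v)(j) = v((j - 1) mod n); n is added to avoid truncated subtraction. *)
Definition Tmx : 'M[F]_n :=
  \matrix_(j, k) ((k : nat) == ((j + n - 1) %% n)%N)%:R.

(* (D v)(j) = v((n - j) mod n) *)
Definition Dmx : 'M[F]_n :=
  \matrix_(j, k) ((k : nat) == ((n - j) %% n)%N)%:R.

Definition GL_subgroup (H : set 'M[F]_n) : Prop :=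
  [/\ H `<=` [set g | g \in unitmx], H 1%:M,
      forall g h, H g -> H h -> H (g *m h) &
      forall g, H g -> H (invmx g)].

Definition GL_generated (A : set 'M[F]_n) : set 'M[F]_n :=
  [set g | forall H, GL_subgroup H -> A `<=` H -> H g].

Definition dihedral_mx : set 'M[F]_n := GL_generated [set Tmx; Dmx].

Definition dihedral_orbit (w : 'cV[F]_n) : set 'cV[F]_n :=
  [set g *m w | g in dihedral_mx].

Definition full_spark_frame (V : set 'cV[F]_n) : Prop :=
  [/\ finite_set V, (n <= #|` fset_set V|)%N &
      forall B : {fset 'cV[F]_n},
        [set` B] `<=` V -> #|` B| = n -> basis_of fullv (enum_fset B)].

End Dihedral.

Section Digamma.
Variables (R : realType) (n : nat).

Definition expi (t : R) : R[i] := cos t +i* sin t.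

Definition transcendental (x : R[i]) : Prop :=
  ~ algebraicOver (ratr : rat -> R[i]) x.

Definition cyclotomic_field : {pred R[i]} :=
  gen_subfield (expi (2 * pi / n%:R)).

Definition lambda_vec (lambda : R[i]) : 'cV[R[i]]_n :=
  \col_(j < n) \sum_(k < n)
     lambda ^+ k * expi (- (2 * pi * k%:R * j%:R / n%:R)).

Definition digamma_vectors : set 'cV[R[i]]_n :=
  [set w | exists lambda : R[i], w = lambda_vec lambda /\
     (transcendental lambda \/
      exists2 d : nat, algebraic_of_degree cyclotomic_field lambda d &
                       (n ^ 2 - n + 1 <= d)%N)].

End Digamma.

(* Main.v *)
Require Import Defs.
From HB Require Import structures.
From mathcomp Require Import all_boot all_order all_algebra.
From mathcomp Require Import perm finmap.
From mathcomp Require Import all_classical all_reals.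
From mathcomp Require Import trigo.
From mathcomp.real_closed Require Import complex.
From mathcomp Require Import zify lra.
Local Open Scope classical_set_scope.
Local Open Scope ring_scope.
Local Open Scope complex_scope.

Set Implicit Arguments.
Unset Strict Implicit.
Unset Printing Implicit Defensive.

Import Order.TTheory GRing.Theory Num.Theory.

(** Write zeta = e^(2 i pi / n) and omega = zeta^-1.  The vector w is the
    discrete Fourier transform of (1, lambda, ..., lambda^(n-1)), and the
    transform turns T into multiplication of the k-th Fourier coefficient by
    zeta^k and D into the index reversal k |-> -k mod n.  Hence the orbit
    consists of the transforms of the vectors
        k |-> lambda^k z^k   and   k |-> lambda^(-k mod n) z^k,   z^n = 1
    ([Tmx_orbit_vec], [Dmx_orbit_vec], [dihedral_orbit_sub]).  The transform
    being injective ([dft_eq0]), n of the orbit vectors are independent as soon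
    as the n x n determinant of their Fourier coefficients is nonzero.

    That determinant is the value at lambda of a polynomial P with coefficients
    in Q(zeta) and degree at most n (n - 1).  If P is not the zero polynomial,
    then P(lambda) != 0: for lambda algebraic, its degree over Q(zeta) exceeds
    deg P; for lambda transcendental, a root of P would be algebraic over
    Q(zeta), hence over Q ([algebraic_over_gen_subfield]).

    It remains to see that P != 0 ([det_dihedral_neq0]); this is where n odd is
    used.  Say that p of the n vectors are of the first kind.  A term of the
    Leibniz expansion assigns the coefficient indices to the vectors; its degree
    is determined by the set S of the p indices given to vectors of the first
    kind, and putting k in S instead of outside changes the degree by
    k - (-k mod n).  This gain is 0 for k = 0 and the odd number 2 k - n for
    0 < k < n, so the n gains are distinct and a single set S maximizes the
    degree: the p indices with the largest gain.  In the cyclic order these are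
    p consecutive residues, and the other n - p residues are consecutive as
    well.  The leading coefficient of P is therefore, up to sign, a product of
    two minors of Vandermonde type with consecutive exponents, and does not
    vanish ([power_sums_eq0]).  The passage from P to this coefficient is done
    by potentials on the rows and columns that bound the exponents, with equality
    exactly in the two blocks ([det_monomials_neq0]). *)

(** * Determinants of monomial matrices *)

(** By linearity the hypothesis says that the weights [u i * z i ^+ m] annihilate
    every polynomial of degree less than [#|A|]; the one vanishing at all the
    [z l] except [z i] isolates [u i].  This is the invertibility of a
    Vandermonde matrix with consecutive exponents, without choosing an ordering
    of [A]. *)
Lemma power_sums_eq0 (F : fieldType) (I : finType) (A : {pred I})
    (z u : I -> F) (m : nat) :
  {in A &, injective z} -> {in A, forall i, z i != 0} ->
  (forall j, (j < #|A|)%N -> \sum_(i in A) u i * z i ^+ (m + j) = 0) ->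
  {in A, forall i, u i = 0}.
Proof.
move=> z_inj z_neq0 sum0 i Ai.
pose r := enum [predD1 A & i].
pose q := \prod_(y <- [seq z l | l <- r]) ('X - y%:P).
have size_q : size q = #|A|.
  by rewrite size_prod_XsubC size_map -cardE (cardD1 i A) Ai.
have sum_q : \sum_(l in A) u l * z l ^+ m * q.[z l] = 0.
  under eq_bigr do rewrite horner_coef mulr_sumr.
  rewrite exchange_big big1 //= => j _.
  under eq_bigr do rewrite mulrCA -mulrA -exprD.
  by rewrite -mulr_sumr sum0 ?mulr0 // -size_q.
move: sum_q; rewrite (bigD1 i) //= big1 => [|l /andP[Al li]]; last first.
  suff /rootP -> : root q (z l) by rewrite mulr0.
  by rewrite root_prod_XsubC map_f // mem_enum !inE li.
rewrite addr0 => /eqP; rewrite !mulf_eq0 expf_eq0 (negPf (z_neq0 i Ai)) andbF orbF.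
suff /negPf -> : q.[z i] != 0 by rewrite orbF => /eqP.
rewrite -/(root q (z i)) root_prod_XsubC.
apply/mapP => -[l]; rewrite mem_enum !inE => /andP[li Al] /z_inj.
by move=> /(_ Ai Al) il; rewrite il eqxx in li.
Qed.

(** The potentials [r] and [c] bound the degree of every Leibniz term by half
    of their total sum, and a term attains this bound iff all its entries are
    tight.  So the coefficient of that degree is the determinant of the matrix
    of tight entries.  The exponents are doubled because the potentials needed
    below are half-integers. *)
Lemma det_monomials_neq0 (F : fieldType) (n : nat) (a : 'I_n -> 'I_n -> F)
    (e : 'I_n -> 'I_n -> nat) (r c : 'I_n -> int) :
  (forall i k, (2 * e i k)%:Z <= r i + c k) ->
  \det (\matrix_(i, k) (a i k *+ ((2 * e i k)%:Z == r i + c k))) != 0 ->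
  \det (\matrix_(i, k) (a i k *: 'X^(e i k))) != 0 :> {poly F}.
Proof.
move=> le_rc.
set N := \matrix_(i, k) _ => detN.
pose d (s : 'S_n) := (\sum_i e i (s i))%N.
pose top := \sum_i r i + \sum_k c k.
pose tight (s : 'S_n) := [forall i, (2 * e i (s i))%:Z == r i + c (s i)].
have topE (s : 'S_n) : top = \sum_i (r i + c (s i)).
  by rewrite big_split; congr (_ + _); apply: (reindex_inj (@perm_inj _ s)).
have dE (s : 'S_n) : (2 * d s)%:Z = \sum_i (2 * e i (s i))%:Z.
  rewrite /d big_distrr /=; exact: (big_morph Posz PoszD (erefl _)).
have tightE (s : 'S_n) : tight s = ((2 * d s)%:Z == top).
  rewrite dE (topE s) [RHS]eq_sym -subr_eq0 -sumrB psumr_eq0; last first.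
    by move=> i _; rewrite subr_ge0.
  by apply/forallP/allP => /= h i => [_|]; have := h i;
    rewrite ?mem_index_enum subr_eq0 eq_sym // => /(_ isT).
have prodN (s : 'S_n) : \prod_i N i (s i) = (\prod_i a i (s i)) *+ tight s.
  have [/forallP t_s|] := boolP (tight s).
    by apply: eq_bigr => i _; rewrite mxE t_s.
  rewrite negb_forall => /existsP[i /negPf t_i].
  by rewrite (bigD1 i) //= mxE t_i mul0r.
(* A tight permutation exists, since otherwise every term of \det N is zero;
   its degree is the one at which to read the coefficient. *)
have [s0 t_s0] : exists s0, tight s0.
  apply/existsP; apply: contraNT detN; rewrite negb_exists => /forallP no_t.
  by apply/eqP; apply: big1 => s _; rewrite prodN (negPf (no_t s)) mulr0.
suff : (\det (\matrix_(i, k) (a i k *: 'X^(e i k))))`_(d s0) = \det N.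
  by move=> coefN; apply: contraNneq detN => q0; rewrite -coefN q0 coef0.
rewrite /determinant coef_sum; apply: eq_bigr => s _.
rewrite prodN tightE; move: t_s0; rewrite tightE => /eqP <-.
under eq_bigr do rewrite mxE.
rewrite scaler_prod prodrXr !mulr_sign.
have -> : (2 * d s)%:Z == (2 * d s0)%:Z = (d s0 == d s) by lia.
by case: odd_perm; rewrite ?coefN coefZ coefXn mulr_natr.
Qed.

(** * The dihedral determinant as a polynomial in lambda *)

(** For [k < n] and [s] true this is the residue of [- k] modulo [n]; the form
    without [%%] keeps the inequalities below within linear arithmetic. *)
Definition fourier_exp (n : nat) (s : bool) (k : nat) : nat :=
  if s && (0 < k)%N then (n - k)%N else k.

(** Rows with [s i] false are the p vectors of the first kind.  The index set
    [top] collects the p columns for which the gain [k - (- k mod n)] is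
    largest; [theta / 2] is a threshold strictly between the gains of the columns
    in [top] and the gains of the others.  With potential [theta] on the rows of
    the first kind and 0 on the others, the tight entries are two diagonal
    blocks, each with cyclically consecutive columns. *)
Lemma det_dihedral_neq0 (F : fieldType) (n : nat) (z : 'I_n -> F)
    (s : 'I_n -> bool) :
  odd n -> (forall i, z i ^+ n = 1) -> injective (fun i => (z i, s i)) ->
  \det (\matrix_(i, k) (z i ^+ k *: 'X^(fourier_exp n (s i) k))) != 0
    :> {poly F}.
Proof.
move=> odd_n z_n zs_inj.
have n_gt0 : (0 < n)%N by case: (n) odd_n.
pose p := #|[pred i | ~~ s i]|.
have cardT : (#|[pred i | s i]| = n - p)%N.
  by rewrite -[n in RHS]card_ord -(cardC [pred i | s i]) addnK.
have le_p : (p <= n)%N by rewrite -[n in leqRHS]card_ord max_card.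
pose t : nat := (n < 2 * p)%N.
have tP : (n < 2 * p)%N /\ t = 1%N \/ (2 * p < n)%N /\ t = 0%N.
  by rewrite /t; case: ltnP => hp; [left | right; split => //; lia].
(* [top] is the cyclic interval of the p residues n - p + t, n - p + t + 1, ...:
   index 0, of gain 0, belongs to it iff more than half of the rows are of the
   first kind. *)
pose top (k : nat) := if k == 0%N then (n < 2 * p)%N else (n - p + t <= k)%N.
(* For t = 0 the least gain inside [top] is n - 2 p and the gains outside are at
   most max (n - 2 p - 2) 0 <= n - 2 p - 1, so theta / 2 = n - 2 p - 1/2 separates
   them; for t = 1 the gains outside are at most n - 2 p and those inside at
   least min (n - 2 p + 2) 0 >= n - 2 p + 1, so n - 2 p + 1/2 does. *)
pose theta : int := 2 * n%:Z - 4 * p%:Z - 1 + 2 * t%:Z.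
pose r i : int := if s i then 0 else theta.
pose c (k : 'I_n) : int :=
  if top k then 2 * k%:Z - theta else (2 * fourier_exp n true k)%:Z.
have le_rc (i k : 'I_n) : ((2 * fourier_exp n (s i) k)%:Z <= r i + c k)
    * (((2 * fourier_exp n (s i) k)%:Z == r i + c k) = (s i != top k)).
  have := ltn_ord k; rewrite /r /c /top /theta /fourier_exp.
  move: (k : nat) => {}k lt_k; rewrite [t]lock in tP *.
  case: (s i) => /=; case: (posnP k) => hk; rewrite ?hk ?(gtn_eqF hk) /=;
    split; do ?case: ifP => ?; lia.
apply: (det_monomials_neq0 (r := r) (c := c)) => [i k|]; first by rewrite le_rc.
apply/det0P => -[u /negP u_neq0 uN]; apply: u_neq0.
(* A vector in the left kernel satisfies power sum equations on each block. *)
have sum0 (k : 'I_n) : \sum_(i | s i != top k) u 0 i * z i ^+ k = 0.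
  have := congr1 (fun M : 'rV_n => M 0 k) uN; rewrite !mxE => sumN.
  rewrite -[RHS]sumN [LHS]big_mkcond; apply: eq_bigr => i _.
  by rewrite mxE le_rc; case: ifP; rewrite ?mulr1n ?mulr0n ?mulr0.
have z_neq0 i : z i != 0.
  apply: contraTneq (oner_neq0 F) => zi0.
  by rewrite -(z_n i) zi0 expr0n gtn_eqF // eqxx.
apply/eqP/rowP => i; rewrite [RHS]mxE.
have : {in [pred i | ~~ s i], forall i, u 0 i = 0}.
  apply: (power_sums_eq0 (m := n - p + t)%N) => [j l|//|j lt_j].
    rewrite !inE => /negPf sj /negPf sl zjl; apply: zs_inj.
    by rewrite sj sl zjl.
  pose k := Ordinal (ltn_pmod (n - p + t + j) n_gt0).
  have lt_p : (j < p)%N by [].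
  (* If the interval wraps around, then only its last residue, n, does. *)
  have top_k : top k.
    rewrite /top /=; have [lt_n|ge_n] := ltnP (n - p + t + j) n.
      by rewrite modn_small //; case: ifP; lia.
    have -> : (n - p + t + j = n)%N by lia.
    by rewrite modnn /=; lia.
  rewrite -[RHS](sum0 k); apply: eq_big => l.
    by rewrite !inE top_k; case: (s l).
  by rewrite /= expr_mod.
have : {in [pred i | s i], forall i, u 0 i = 0}.
  apply: (power_sums_eq0 (m := t)%N) => [j l|//|j lt_j].
    by rewrite !inE => sj sl zjl; apply: zs_inj; rewrite sj sl zjl.
  have lt_q : (j < n - p)%N by rewrite -cardT.
  have lt_k : (t + j < n)%N by lia.
  have not_top : top (t + j) = false by rewrite /top; case: ifP; lia.
  rewrite -[RHS](sum0 (Ordinal lt_k)); apply: eq_big => l //.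
  by rewrite !inE not_top; case: (s l).
by case si : (s i) => u1 u2; [apply: u1 | apply: u2]; rewrite !inE si.
Qed.

Lemma size_det_leq (F : idomainType) (n d : nat) (M : 'M[{poly F}]_n) :
  (forall i j, (size (M i j) <= d.+1)%N) -> (size (\det M) <= (n * d).+1)%N.
Proof.
move=> size_M; apply: leq_trans (size_sum _ _ _) _; apply/bigmax_leqP => s _.
rewrite size_Msign (leq_trans (size_poly_prod_leq _ _)) //.
have -> : #|(xpredT : pred 'I_n)| = n by apply: card_ord.
rewrite leq_subLR addnS ltnS -mulnS -[n in leqRHS]card_ord -sum_nat_const.
by apply: leq_sum => i _; apply: size_M.
Qed.

Lemma fourier_exp_lt (n : nat) (s : bool) (k : 'I_n) :
  (fourier_exp n s k < n)%N.
Proof. by rewrite /fourier_exp; have := ltn_ord k; case: ifP; lia. Qed.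

(** The hypothesis on roots is what the two conditions on [lambda] have in common;
    all exponents being less than [n], the determinant has degree at most
    [n * (n - 1)] in [lambda], which the hypothesis excludes. *)
Lemma det_dihedral_eval_neq0 (F : fieldType) (K : subringClosed F) (n : nat)
    (lambda : F) (z : 'I_n -> F) (s : 'I_n -> bool) :
  odd n ->
  (forall q : {poly F}, q \is a polyOver K -> q != 0 -> root q lambda ->
     (n ^ 2 - n + 1 < size q)%N) ->
  (forall i, z i \in K) -> (forall i, z i ^+ n = 1) ->
  injective (fun i => (z i, s i)) ->
  \det (\matrix_(i, k) (lambda ^+ fourier_exp n (s i) k * z i ^+ k)) != 0.
Proof.
move=> odd_n big_deg zK z_n zs_inj.
pose P : 'M_n := \matrix_(i, k) (z i ^+ k *: 'X^(fourier_exp n (s i) k)).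
have P_neq0 : \det P != 0 by apply: det_dihedral_neq0.
have PK : \det P \is a polyOver K.
  apply: rpred_sum => t _; rewrite rpredMsign rpred_prod // => i _.
  by rewrite mxE polyOverZ ?rpredX ?polyOverX.
have size_P : (size (\det P) <= (n * n.-1).+1)%N.
  apply: size_det_leq => i k; rewrite mxE (leq_trans (size_scale_leq _ _)) //.
  by rewrite size_polyXn ltnS; have := fourier_exp_lt (s i) k; lia.
have -> : \matrix_(i, k) (lambda ^+ fourier_exp n (s i) k * z i ^+ k) =
          map_mx (horner_eval lambda) P.
  by apply/matrixP => i k; rewrite !mxE /horner_eval !hornerE mulrC.
rewrite det_map_mx; apply/negP => P_root.
have := big_deg _ PK P_neq0 P_root.
by rewrite -mulnn -[X in (_ - X)%N]muln1 -mulnBr subn1 addn1 ltnNge size_P.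
Qed.

(** * The orbit in Fourier coordinates *)

Definition dft (F : fieldType) (n : nat) (omega : F) (c : 'I_n -> F) : 'cV[F]_n :=
  \col_(j < n) \sum_(k < n) c k * omega ^+ (k * j).

(** The pair [zs] is a root of unity together with the choice of a rotation of
    [w] (false) or of its reflection (true). *)
Definition orbit_vec (F : fieldType) (n : nat) (omega lambda : F)
    (zs : F * bool) : 'cV[F]_n :=
  dft omega (fun k => lambda ^+ fourier_exp n zs.2 k * zs.1 ^+ k).

(** The Fourier matrix is itself a Vandermonde matrix, with nodes the powers of
    [omega]. *)
Lemma dft_eq0 (F : fieldType) (n : nat) (omega : F) (c : 'I_n -> F) :
  n.-primitive_root omega -> dft omega c = 0 -> forall k, c k = 0.
Proof.
move=> prim_w c0 k.
apply: (@power_sums_eq0 _ _ predT (fun k : 'I_n => omega ^+ k) c 0) => //.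
- move=> i j _ _ /eqP; rewrite (eq_prim_root_expr prim_w) !modn_small //.
  by move=> /eqP/val_inj.
- move=> i _; rewrite expf_neq0 // (prim_root_eq0 prim_w) -lt0n.
  exact: prim_order_gt0 prim_w.
move=> j; rewrite card_ord => lt_j.
have := congr1 (fun v : 'cV_n => v (Ordinal lt_j) 0) c0.
by rewrite !mxE => cj0; rewrite -[RHS]cj0; apply: eq_bigr => i _; rewrite exprM.
Qed.

Lemma orbit_vec_indep (F : fieldType) (n : nat) (omega lambda : F)
    (zs : 'I_n -> F * bool) (u : 'I_n -> F) :
  n.-primitive_root omega ->
  \det (\matrix_(i, k) (lambda ^+ fourier_exp n (zs i).2 k * (zs i).1 ^+ k)) != 0 ->
  \sum_i u i *: orbit_vec n omega lambda (zs i) = 0 -> forall i, u i = 0.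
Proof.
set G := \matrix_(i, k) _ => prim_w detG sum0 i.
suff uG : \row_i u i *m G = 0.
  have u0 : \row_i u i = 0.
    by apply: contraNeq detG => u_neq0; apply/det0P; exists (\row_i u i).
  by have := congr1 (fun M : 'rV_n => M 0 i) u0; rewrite !mxE.
apply/rowP => k; rewrite [RHS]mxE.
apply: (dft_eq0 prim_w (c := fun k => (\row_i u i *m G) 0 k)).
rewrite -[RHS]sum0; apply/colP => j; rewrite mxE [RHS]summxE.
under [LHS]eq_bigr do rewrite mxE mulr_suml.
rewrite exchange_big; apply: eq_bigr => l _ /=; rewrite !mxE mulr_sumr.
by apply: eq_bigr => m _; rewrite [G _ _]mxE -mulrA.
Qed.

Lemma expr_order_sub (F : fieldType) (x : F) (n k : nat) :
  (k <= n)%N -> x ^+ n = 1 -> x ^+ (n - k) = x^-1 ^+ k.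
Proof.
case: n => [|n]; first by rewrite leqn0 => /eqP ->.
move=> le_kn x_n; have x_neq0 : x != 0.
  by apply: contraTneq (oner_neq0 F) => x0; rewrite -x_n x0 expr0n eqxx.
by rewrite expfB_cond // ?x_n ?div1r ?exprVn // (negPf x_neq0).
Qed.

Lemma Tmx_perm (F : fieldType) (n : nat) :
  Tmx F n = perm_mx (perm (@ord_pred_inj n)).
Proof.
by apply/matrixP => i j; rewrite !mxE permE subn1 -val_eqE /= eq_sym.
Qed.

Definition ord_opp (n : nat) (j : 'I_n) : 'I_n :=
  Ordinal (ltn_pmod (n - j) (leq_ltn_trans (leq0n j) (ltn_ord j))).

Lemma ord_oppK (n : nat) : involutive (@ord_opp n).
Proof.
move=> k; apply/val_inj => /=; have := ltn_ord k.
case: (posnP k) => [-> _|k_gt0 lt_k]; first by rewrite subn0 modnn subn0 modnn.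
rewrite (@modn_small (n - k)); last by lia.
by rewrite subKn ?modn_small // ltnW.
Qed.

Lemma Dmx_perm (F : fieldType) (n : nat) :
  Dmx F n = perm_mx (perm (inv_inj (@ord_oppK n))).
Proof. by apply/matrixP => i j; rewrite !mxE permE -val_eqE /= eq_sym. Qed.

Lemma fourier_exp_opp (n : nat) (s : bool) (k : 'I_n) :
  fourier_exp n s (ord_opp k) = fourier_exp n (~~ s) k.
Proof.
rewrite /fourier_exp /=; have := ltn_ord k.
case: (posnP k) => [-> _|k_gt0 lt_k]; first by rewrite subn0 modnn !andbF.
rewrite modn_small; last by lia.
by rewrite subn_gt0 lt_k !andbT; case: s => //=; rewrite subKn // ltnW.
Qed.

Lemma expr_ord_opp (F : fieldType) (x : F) (n : nat) (k : 'I_n) :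
  x ^+ n = 1 -> x ^+ ord_opp k = x^-1 ^+ k.
Proof. by move=> x_n; rewrite expr_mod // expr_order_sub // ltnW. Qed.

Lemma Tmx_orbit_vec (F : fieldType) (n : nat) (omega lambda : F) zs :
  omega ^+ n = 1 ->
  Tmx F n *m orbit_vec n omega lambda zs =
    orbit_vec n omega lambda (zs.1 * omega^-1, zs.2).
Proof.
move=> w_n; apply/colP => j; rewrite Tmx_perm -row_permE !mxE permE /=.
apply: eq_bigr => k _ /=.
rewrite exprMn -!mulrA; congr (_ * (_ * _)).
have n_gt0 : (0 < n)%N by apply: leq_ltn_trans (ltn_ord j).
rewrite mulnC exprM expr_mod // -subn1 addnC -addnBAC // exprD expr_order_sub //.
by rewrite expr1 exprMn -!exprM [(j * k)%N]mulnC.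
Qed.

(** Reversing the coordinates of a Fourier transform amounts to reversing the
    coefficients; on monomials this swaps the two kinds of exponents and inverts
    [z]. *)
Lemma Dmx_orbit_vec (F : fieldType) (n : nat) (omega lambda : F) zs :
  omega ^+ n = 1 -> zs.1 ^+ n = 1 ->
  Dmx F n *m orbit_vec n omega lambda zs =
    orbit_vec n omega lambda (zs.1^-1, ~~ zs.2).
Proof.
move=> w_n z_n; apply/colP => j; rewrite Dmx_perm -row_permE !mxE permE.
rewrite (reindex_inj (inv_inj (@ord_oppK n))); apply: eq_bigr => k _.
rewrite fourier_exp_opp expr_ord_opp //; congr (_ * _ * _).
have wk_n : (omega^-1 ^+ k) ^+ n = 1 by rewrite exprAC exprVn w_n invr1 expr1n.
by rewrite exprM expr_ord_opp // expr_ord_opp // [omega^-1 ^+ k]exprVn invrK exprM.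
Qed.

(** * The dihedral orbit *)

(** The invertible matrices preserving [O] in both directions form a subgroup;
    the equivalence, rather than one implication, is what makes it closed under
    inverses. *)
Lemma GL_generated_stable (F : fieldType) (n : nat) (A : set 'M[F]_n)
    (O : set 'cV[F]_n) :
  (forall g, A g -> g \in unitmx /\ forall x, O (g *m x) <-> O x) ->
  forall g, GL_generated A g -> forall x, O (g *m x) <-> O x.
Proof.
move=> stabA g genA.
have [] // : [set g | g \in unitmx /\ forall x, O (g *m x) <-> O x] g.
apply: genA => //; split=> [h [] //| |g1 g2 [u1 O1] [u2 O2]|h [uh Oh]].
- by split=> [|x]; rewrite ?unitmx1 ?mul1mx.
- by split=> [|x]; rewrite ?unitmx_mul ?u1 // -mulmxA O1.
- by split=> [|x]; rewrite ?unitmx_inv // -Oh mulKVmx.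
Qed.

Lemma GL_generated_sub (F : fieldType) (n : nat) (A : set 'M[F]_n) :
  A `<=` GL_generated A.
Proof. by move=> g Ag H _; apply. Qed.

Lemma GL_generated1 (F : fieldType) (n : nat) (A : set 'M[F]_n) :
  GL_generated A 1%:M.
Proof. by move=> H []. Qed.

Lemma GL_generatedM (F : fieldType) (n : nat) (A : set 'M[F]_n) g h :
  GL_generated A g -> GL_generated A h -> GL_generated A (g *m h).
Proof.
move=> Ag Ah H sgH AH; case: (sgH) => _ _ HM _.
by apply: HM; [apply: Ag|apply: Ah].
Qed.

Definition orbit_family (F : fieldType) (n : nat) (omega lambda : F) :
    set 'cV[F]_n :=
  [set orbit_vec n omega lambda zs | zs in [set zs : F * bool | zs.1 ^+ n = 1]].

Lemma dihedral_orbit_sub (F : fieldType) (n : nat) (omega lambda : F)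
    (w : 'cV[F]_n) :
  omega ^+ n = 1 -> (0 < n)%N -> orbit_family omega lambda w ->
  dihedral_orbit w `<=` orbit_family omega lambda.
Proof.
move=> w_n n_gt0 Ow _ [g Dg <-].
have w_neq0 : omega != 0.
  by apply: contraTneq (oner_neq0 F) => w0; rewrite -w_n w0 expr0n gtn_eqF // eqxx.
suff stab g' x : [set Tmx F n; Dmx F n] g' ->
    g' \in unitmx /\ (orbit_family omega lambda (g' *m x) <->
                      orbit_family omega lambda x).
  apply: (GL_generated_stable _ Dg w).2 Ow => h Ah.
  by split=> [|y]; [case: (stab h 0 Ah)|case: (stab h y Ah)].
move=> [->|->].
  have uT : Tmx F n \in unitmx by rewrite Tmx_perm unitmx_perm.
  split=> //; split=> [[zs /= zn Tx]|[zs /= zn <-]].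
    exists (zs.1 * omega, zs.2); first by rewrite /= exprMn zn w_n mulr1.
    apply: (can_inj (mulKmx uT)); rewrite -Tx Tmx_orbit_vec //= mulfK //.
  exists (zs.1 / omega, zs.2); last by rewrite Tmx_orbit_vec.
  by rewrite /= exprMn exprVn zn w_n invr1 mulr1.
have uD : Dmx F n \in unitmx by rewrite Dmx_perm unitmx_perm.
split=> //; split=> [[zs /= zn Dx]|[zs /= zn <-]].
  exists (zs.1^-1, ~~ zs.2); first by rewrite /= exprVn zn invr1.
  apply: (can_inj (mulKmx uD)); rewrite -Dx Dmx_orbit_vec //= ?exprVn ?zn ?invr1 //.
  by rewrite invrK negbK.
exists (zs.1^-1, ~~ zs.2); last by rewrite Dmx_orbit_vec.
by rewrite /= exprVn zn invr1.
Qed.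

(** These rotations supply the n distinct vectors that the orbit of a frame must
    contain. *)
Lemma dihedral_orbit_rot (F : fieldType) (n : nat) (omega lambda : F) a :
  omega ^+ n = 1 ->
  dihedral_orbit (orbit_vec n omega lambda (1, false))
    (orbit_vec n omega lambda (omega^-1 ^+ a, false)).
Proof.
move=> w_n; elim: a => [|a [g Dg gE]].
  by exists 1%:M; rewrite ?mul1mx //; apply: GL_generated1.
exists (Tmx F n *m g).
  by apply: GL_generatedM => //; apply: GL_generated_sub; left.
by rewrite -mulmxA gE Tmx_orbit_vec //= exprSr.
Qed.

(** Distinct vectors have distinct parameters [zs], so [n] distinct orbit vectors
    are covered by the nonvanishing of the determinant.  Applied to the rotations
    of [w], the same independence shows that they are pairwise distinct, which
    gives the lower bound on the cardinal. *)
Lemma dihedral_orbit_full_spark (F : fieldType) (K : subringClosed F) (n : nat)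
    (omega lambda : F) :
  odd n -> n.-primitive_root omega -> omega \in K ->
  (forall q : {poly F}, q \is a polyOver K -> q != 0 -> root q lambda ->
     (n ^ 2 - n + 1 < size q)%N) ->
  full_spark_frame (dihedral_orbit (orbit_vec n omega lambda (1, false))).
Proof.
move=> odd_n prim_w wK big_deg; set V := dihedral_orbit _.
have n_gt0 := prim_order_gt0 prim_w.
have w_n := prim_expr_order prim_w.
have w_neq0 : omega != 0 by rewrite (prim_root_eq0 prim_w) -lt0n.
have indep (zs : 'I_n -> F * bool) (u : 'I_n -> F) :
    (forall i, (zs i).1 ^+ n = 1) -> injective zs ->
    \sum_i u i *: orbit_vec n omega lambda (zs i) = 0 -> forall i, u i = 0.
  move=> zn zs_inj; apply: orbit_vec_indep => //.
  apply: (det_dihedral_eval_neq0 (K := K)) => // [i|i j /= [z_ij s_ij]].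
    by have [k ->] := prim_rootP prim_w (zn i); rewrite rpredX.
  by apply: zs_inj; rewrite [zs i]surjective_pairing z_ij s_ij -surjective_pairing.
have V_sub : V `<=` orbit_family omega lambda.
  by apply: dihedral_orbit_sub => //; exists (1, false); rewrite //= expr1n.
have fin_V : finite_set V.
  apply: sub_finite_set V_sub _.
  pose vec (p : 'I_n * bool) := orbit_vec n omega lambda (omega ^+ p.1, p.2).
  apply: (@sub_finite_set _ _ (vec @` setT)).
    move=> _ [[z s] /= zn <-]; have [i zE] := prim_rootP prim_w zn.
    by exists (i, s); rewrite // /vec zE.
  by apply: finite_image; apply: finite_finset.
split=> //.
  pose rot (i : 'I_n) := (omega^-1 ^+ i, false).
  have rot_n i : (rot i).1 ^+ n = 1 by rewrite /= exprAC exprVn w_n invr1 expr1n.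
  have rot_inj : injective rot.
    move=> i j [/eqP]; rewrite !exprVn (inj_eq invr_inj) (eq_prim_root_expr prim_w).
    by rewrite !modn_small // => /eqP/val_inj.
  rewrite -[n in leqLHS]card_ord cardE.
  rewrite -(size_map (fun i => orbit_vec n omega lambda (rot i))).
  apply: uniq_leq_size => [|_ /mapP[i _ ->]].
    rewrite map_inj_uniq ?enum_uniq // => i j vec_ij; apply/eqP/negPn/negP => ij.
    (* Two equal vectors would give the nontrivial relation v_i - v_j = 0. *)
    have := indep rot (fun k => (k == i)%:R - (k == j)%:R) rot_n rot_inj.
    rewrite (eq_bigr _ (fun k _ => scalerBl _ _ _)) sumrB.
    have delta l : \sum_k (k == l)%:R *: orbit_vec n omega lambda (rot k) =
                   orbit_vec n omega lambda (rot l).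
      rewrite (bigD1 l) //= eqxx scale1r big1 ?addr0 // => k /negPf ->.
      by rewrite scale0r.
    rewrite !delta vec_ij subrr => /(_ erefl i) /eqP.
    by rewrite eqxx (negPf ij) subr0 oner_eq0.
  by rewrite in_fset_set //; apply/mem_set; apply: dihedral_orbit_rot.
move=> B BV cardB.
have sizeB : size (enum_fset B) == n by rewrite -[X in _ == X]cardB.
pose X := Tuple sizeB.
rewrite basisEfree subvf dimvf /dim /= muln1 (eqP sizeB) leqnn andbT /=.
have /choice[zs zsP] (i : 'I_n) :
    exists zs, zs.1 ^+ n = 1 /\ orbit_vec n omega lambda zs = X`_i.
  have /V_sub[zs zn <-] : V X`_i by apply: BV; rewrite /= mem_nth // (eqP sizeB).
  by exists zs.
rewrite -[enum_fset B]/(tval X); apply/freeP => u sum0.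
apply: (indep zs) => [i|i j zs_ij|]; first by case: (zsP i).
  apply/val_inj/eqP; rewrite -(nth_uniq 0 _ _ (fset_uniq B)) ?(eqP sizeB);
    do ?exact: ltn_ord.
  by rewrite -[_`_i](zsP i).2 -[_`_j](zsP j).2 zs_ij.
by rewrite -[RHS]sum0; apply: eq_bigr => i _; case: (zsP i) => _ ->.
Qed.

(** * The field generated by an algebraic element *)

Lemma gen_subfield_divring_closed (L : fieldType) (x : L) :
  divring_closed (gen_subfield x).
Proof.
split=> [|y z /asboolP yS /asboolP zS|y z /asboolP yS /asboolP zS];
  apply/asboolP => S Sdiv Sx; have [S1 SB Sd] := Sdiv => //.
- by apply: SB; [apply: yS|apply: zS].
- by apply: Sd; [apply: yS|apply: zS].
Qed.

HB.instance Definition _ (L : fieldType) (x : L) :=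
  GRing.isDivringClosed.Build L (gen_subfield x) (gen_subfield_divring_closed x).

Lemma gen_subfield_id (L : fieldType) (x : L) : x \in gen_subfield x.
Proof. by apply/asboolP. Qed.

(** The elements algebraic over [F] form a subfield, hence contain the subfield
    generated by any one of them. *)
Lemma gen_subfield_algebraic (F L : fieldType) (f : {rmorphism F -> L}) (x y : L) :
  algebraicOver f x -> y \in gen_subfield x -> algebraicOver f y.
Proof.
move=> alg_x /asboolP yS; apply/asboolP.
apply: (yS [pred t | `[< algebraicOver f t >]]); last exact/asboolP.
split=> [|s t /asboolP alg_s /asboolP alg_t|s t /asboolP alg_s /asboolP alg_t];
  apply/asboolP; first exact: algebraic1.
- exact: algebraic_sub.
- exact: algebraic_div.
Qed.

(** A subfield generated by an algebraic element creates no new algebraic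
    elements; for [x] a root of unity this turns transcendence over Q into
    transcendence over Q(x). *)
Lemma algebraic_over_gen_subfield (F L : fieldType) (f : {rmorphism F -> L})
    (x y : L) (q : {poly L}) :
  algebraicOver f x -> q \is a polyOver (gen_subfield x) -> q != 0 ->
  root q y -> algebraicOver f y.
Proof.
move=> alg_x /polyOverP qK q_neq0 qy0; apply/integral_algebraic.
apply: (integral_root q_neq0 qy0) => i i_q; apply/integral_algebraic.
by apply: gen_subfield_algebraic alg_x _; have /(nthP 0)[k _ <-] := i_q.
Qed.

(** * Specialization to e^(2 i pi / n) *)

Lemma expiD (R : realType) (s t : R) : expi (s + t) = expi s * expi t.
Proof.
by apply/eqP; rewrite eq_complex /= cosD sinD [X in _ && (X == _)]addrC !eqxx.
Qed.

Lemma expi0 (R : realType) : expi 0 = 1 :> R[i].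
Proof. by rewrite /expi cos0 sin0. Qed.

Lemma expiMn (R : realType) (t : R) (k : nat) : expi (k%:R * t) = expi t ^+ k.
Proof.
elim: k => [|k IHk]; first by rewrite mul0r expi0.
by rewrite -natr1 mulrDl mul1r expiD IHk exprSr.
Qed.

Lemma expiN (R : realType) (t : R) : expi (- t) = (expi t)^-1.
Proof.
have e1 : expi (- t) * expi t = 1 by rewrite -expiD addNr expi0.
have e_neq0 : expi t != 0.
  by apply: contraTneq (oner_neq0 R[i]) => e0; rewrite -e1 e0 mulr0 eqxx.
by apply: (mulIf e_neq0); rewrite e1 mulVf.
Qed.

Lemma expi2pi (R : realType) : expi (2 * pi) = 1 :> R[i].
Proof. by rewrite /expi mulr_natl cos2pi sin2pi. Qed.

(** The real part 1 - 2 sin^2 (t / 2) is less than 1, because 0 < t / 2 < pi. *)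
Lemma expi_neq1 (R : realType) (t : R) : 0 < t < 2 * pi -> expi t != 1.
Proof.
move=> t_bd; apply/negP => /eqP/(congr1 (@complex.Re R)) /= cos1.
have sin_gt0 : 0 < sin (t / 2) by apply: sin_gt0_pi; lra.
have : cos (t / 2 *+ 2) = 1 by rewrite -[_ *+ 2]mulr_natr divfK // pnatr_eq0.
rewrite cos_mulr2n cos2sin2 => h.
have : 0 < sin (t / 2) ^+ 2 by rewrite exprn_gt0.
lra.
Qed.

Lemma expi_prim_root (R : realType) (n : nat) :
  (0 < n)%N -> n.-primitive_root (expi (2 * pi / n%:R) : R[i]).
Proof.
move=> n_gt0; have n_gt0R : 0 < n%:R :> R by rewrite ltr0n.
apply/andP; split=> //; apply/forallP => i; apply/eqP.
rewrite unity_rootE -expiMn mulrCA.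
have [->|i_neq] := eqVneq i.+1 n.
  by rewrite divff ?mulr1 ?expi2pi ?eqxx // gt_eqF.
apply/negbTE/expi_neq1.
have lt_i : (i.+1 < n)%N by rewrite ltn_neqAle i_neq ltn_ord.
rewrite !mulr_gt0 ?invr_gt0 ?ltr0n ?pi_gt0 //=.
by rewrite gtr_pMr ?mulr_gt0 ?pi_gt0 // ltr_pdivrMr // mul1r ltr_nat.
Qed.

Lemma lambda_vecE (R : realType) (n : nat) (lambda : R[i]) :
  lambda_vec n lambda =
    orbit_vec n (expi (2 * pi / n%:R))^-1 lambda (1, false).
Proof.
apply/colP => j; rewrite !mxE; apply: eq_bigr => k _.
rewrite expr1n mulr1 -expiN -expiMn; congr (_ * expi _).
by rewrite natrM mulrN; congr (- _); rewrite [RHS]mulrC [RHS]mulrAC !mulrA.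
Qed.

Theorem theorem1 (R : realType) (n : nat) (w : 'cV[R[i]]_n) :
  (2 < n)%N -> odd n -> digamma_vectors w ->
  full_spark_frame (dihedral_orbit w).
Proof.
move=> n_gt2 odd_n [lambda [-> lambdaP]]; rewrite lambda_vecE.
have n_gt0 : (0 < n)%N by apply: ltn_trans n_gt2.
set zeta := expi _ in lambdaP *.
have prim_z : n.-primitive_root zeta by apply: expi_prim_root.
have z_n := prim_expr_order prim_z.
apply: (@dihedral_orbit_full_spark _ (gen_subfield zeta)) => //.
(* The inverse of zeta is zeta^(n - 1), and n - 1 is prime to n. *)
- rewrite -[zeta^-1]expr1 -(expr_order_sub _ z_n) //.
  rewrite (prim_root_exp_coprime _ prim_z).
  by rewrite subn1 coprimePn.
- by rewrite rpredV gen_subfield_id.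
move=> q qK q_neq0 q_lambda.
case: lambdaP => [trans|[d [p [_ _ _ min_p] size_p] d_ge]].
  case: trans; apply: algebraic_over_gen_subfield qK q_neq0 q_lambda.
  exists ('X^n - 1); first by rewrite -size_poly_eq0 size_XnsubC.
  by rewrite rmorphB /= map_polyXn rmorph1 /root !hornerE z_n subrr.
by rewrite (leq_trans _ (min_p q qK q_neq0 q_lambda)) // size_p ltnS.
Qed.
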